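(* For every integer $d\ge 3$, $$\gamma_{2,d} > \gamma_{2,2}^{\,d-1}.$$ In particular $\gamma_{2,3}>\gamma_{2,2}^{2}$, i.e. the identity $\gamma_{2,3}=\gamma_{2,2}^2$ does not hold.
   Context: For strings $A_1,\ldots,A_d$ over a finite alphabet, $L(A_1,\ldots,A_d)$ denotes the length of a longest common (not necessarily contiguous) subsequence of all the $A_i$. For positive integers $n,\sigma,d$, $L_{n,\sigma,d}$ is the random variable $L(A_1,\ldots,A_d)$ where $A_1,\ldots,A_d$ are independent random strings of length $n$ whose characters are chosen uniformly and independently from $\Sigma=\{1,\ldots,\sigma\}$. The constant $\gamma_{\sigma,d}$ is defined as $\gamma_{\sigma,d}=\lim_{n\to\infty}\mathbf{E}[L_{n,\sigma,d}]/n$ (the limit exists by standard subadditivity arguments). *)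

(* Defs.v *)
From HB Require Import structures.
From mathcomp Require Import all_boot all_order all_algebra.
From mathcomp Require Import all_classical all_reals all_analysis.
Set Implicit Arguments.
Unset Strict Implicit.
Unset Printing Implicit Defensive.

Import Order.TTheory GRing.Theory Num.Theory.
Import numFieldNormedType.Exports.

Local Open Scope classical_set_scope.
Local Open Scope ring_scope.

Definition common_subseq (T : eqType) (d : nat) (A : 'I_d -> seq T)
  (w : seq T) : bool := [forall i : 'I_d, subseq w (A i)].

(* Length of a longest common subsequence of [A i], [i < d]. The upper bound
   on [m] only makes the maximum finite: see [lcs_max] and [lcs_attained].
   For [d = 0] every word is common and the value is [0]. *)
Definition lcs (T : finType) (d : nat) (A : 'I_d -> seq T) : nat :=
  (\max_(m < (\max_(i < d) size (A i)).+1
         | [exists w : m.-tuple T, common_subseq A w]) m)%N.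

Lemma lcs_max (T : finType) (d : nat) (A : 'I_d -> seq T) (w : seq T) :
  (0 < d)%N -> common_subseq A w -> (size w <= lcs A)%N.
Proof.
move=> d_gt0 cw; have lt_w : (size w < (\max_(i < d) size (A i)).+1)%N.
  rewrite ltnS; have /forallP/(_ (Ordinal d_gt0)) /size_subseq le_w := cw.
  by apply: leq_trans le_w _; exact: (leq_bigmax (F := fun i => size (A i))).
apply: (@leq_bigmax_cond _ _ (fun m : 'I__ => nat_of_ord m) (Ordinal lt_w)).
by apply/existsP; exists (in_tuple w).
Qed.

Lemma lcs_attained (T : finType) (d : nat) (A : 'I_d -> seq T) :
  exists2 w : seq T, common_subseq A w & size w = lcs A.
Proof.
rewrite /lcs.
apply: (big_ind (fun k => exists2 w, common_subseq A w & size w = k)) =>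
  [|x y [u cu <-] [v cv <-]|m /existsP[w cw]].
- by exists [::] => //; apply/forallP => i; apply: sub0seq.
- by rewrite /maxn; case: ifP => _; [exists v | exists u].
- by exists w; rewrite ?size_tuple.
Qed.

(* The alphabet {1, ..., sigma} is represented by ['I_sigma]. *)
Definition strings (n sigma d : nat) := {ffun 'I_d -> n.-tuple 'I_sigma}.

(* All [d * n] characters are independent and uniform, so that the mass of an
   outcome is the product of the masses of its characters. *)
Definition char_prob (R : realType) (sigma : nat) (c : 'I_sigma) : R :=
  sigma%:R^-1.

Definition strings_prob (R : realType) (n sigma d : nat)
  (A : strings n sigma d) : R :=
  \prod_(i < d) \prod_(j < n) char_prob R (tnth (A i) j).

Definition expectation_lcs (R : realType) (n sigma d : nat) : R :=
  \sum_(A : strings n sigma d)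
    strings_prob R A * (lcs (fun i => A i : seq 'I_sigma))%:R.

Definition lcs_gamma (R : realType) (sigma d : nat) : R :=
  limn (fun n : nat => expectation_lcs R n sigma d / n%:R).

(* Main.v *)
Require Import Defs.
From HB Require Import structures.
From mathcomp Require Import all_boot all_order all_algebra.
From mathcomp Require Import all_classical all_reals all_analysis.
From mathcomp Require Import ring lra zify.

Set Implicit Arguments.
Unset Strict Implicit.
Unset Printing Implicit Defensive.

Import Order.TTheory GRing.Theory Num.Theory.
Import numFieldNormedType.Exports.

Local Open Scope ring_scope.

(** For strings A and B_1, ..., B_k, mark in A the letters used by a longest common
    subsequence with each B_j. The letters marked for all j form a common
    subsequence, and given A the k marked sets are independent; so Jensen's
    inequality gives gamma_{d} >= gamma_2^(d-1), with a strict gain as soon as the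
    probability of being marked differs, on average, between even and odd positions.

    A common subsequence w embeds greedily in A. Whenever a matched letter of A is
    followed by an equal unmatched one (a "slip"), either of the two may be used, and
    always preferring even or always preferring odd positions changes the parity
    balance by twice the number of slips. So it suffices that a longest common
    subsequence has linearly many slips, in A or in B, on average. Pairs (A, B) with few
    slips are rare: between consecutive letters p, c of w, unmatched letters occur
    in only one of A, B, they are all different from c, and without a slip they
    force p = c. Weighting the resulting parses of a random pair by the letter
    probabilities gives a transfer operator of norm exactly 1, and forbidding one
    more pattern, which contradicts maximality, makes it strictly less than 1. *)

(** * Greedy embeddings of a word and the parity of the positions they use *)

Section Embedding.
Variable T : eqType.
Implicit Types (w A : seq T) (c : T) (b : bool).

(* The letter [c] was just matched, and the next letter of [A] is again [c] but is
   not used by the greedy embedding of [w]. *)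
Definition slack c w A : bool := (ohead A == Some c) && (ohead w != Some c).

(* [b] tells whether a slip at the current position is to be used, that is, whether
   the current position has the parity to be avoided. *)
Fixpoint embed b w A : bitseq :=
  match A with
  | [::] => [::]
  | x :: A' =>
    match w with
    | [::] => false :: embed (~~ b) [::] A'
    | c :: w' =>
      if (x == c) && ~~ (b && slack c w' A') then true :: embed (~~ b) w' A'
      else false :: embed (~~ b) w A'
    end
  end.

Fixpoint slips w A : nat :=
  match A, w with
  | x :: A', c :: w' =>
    if x == c then (slack c w' A' + slips w' A')%N else slips w A'
  | _, _ => 0%N
  end.

Lemma size_embed b w A : size (embed b w A) = size A.
Proof.
elim: A b w => [|x A IHA] b [|c w] //=; first by rewrite IHA.
by case: ifP => _; rewrite /= IHA.
Qed.

(** A slip delays a match by one position only: [b] flips, so the next letter, again [c], is taken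
    at once. The rest of the word does not start with [c], hence it still embeds after that
    position. *)
Lemma mask_embed b w A : subseq w A -> mask (embed b w A) A = w.
Proof.
elim: A b w => [|x A IHA] b [|c w] //=; first by move=> _; rewrite IHA ?sub0seq.
rewrite [c == x]eq_sym; have [->|neq_xc] /= := eqVneq x c; last exact: IHA.
case: (boolP (b && slack c w A)) => [/andP[_]|_ sub_w]; last by rewrite /= IHA.
case: A IHA => [|y A] IHA // /andP[/eqP[yc] hw] sub_w; move: IHA sub_w.
rewrite {y}yc => IHA sub_w.
change (mask (embed (~~ b) (c :: w) (c :: A)) (c :: A) = c :: w).
rewrite IHA //= eqxx; case: w hw sub_w => [|e w] //= hw; first by rewrite sub0seq.
by rewrite (_ : (e == c) = false) //; apply: contraNF hw => /eqP ->.
Qed.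

(** Signed count of the marks; for [b = false] it is the number of marked even positions minus that
    of marked odd ones. *)
Fixpoint altsum (R : comNzRingType) b (m : bitseq) : R :=
  if m is x :: m' then (-1) ^+ b * x%:R + altsum R (~~ b) m' else 0.

Lemma slips_nil A : slips [::] A = 0%N. Proof. by case: A. Qed.

Lemma slipsE c w A : ohead w != Some c -> slips w (c :: A) = slips w A.
Proof.
case: w => [|e w]; rewrite ?slips_nil //= => hw.
by rewrite (_ : (c == e) = false) //; apply: contraNF hw => /eqP ->.
Qed.

Lemma embedE b c w A :
  ohead w != Some c -> embed b w (c :: A) = false :: embed (~~ b) w A.
Proof.
case: w => [|e w] //= hw.
by rewrite (_ : (c == e) = false) //; apply: contraNF hw => /eqP ->.
Qed.

(* At each slip the two embeddings use the two different positions of an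
   adjacent pair of equal letters, and they agree elsewhere. *)
Lemma altsum_embed (R : comNzRingType) w A :
  altsum R false (embed false w A) =
    altsum R false (embed true w A) + (slips w A).*2%:R.
Proof.
(* Strong induction on the length, because a slip uses up two letters; [b] is general because the
   sign and the preferred parity switch together at each letter. *)
suff H n b : (size A <= n)%N ->
    altsum R b (embed b w A) = altsum R b (embed (~~ b) w A) + (slips w A).*2%:R.
  exact: H (leqnn _).
elim: n b w A => [|n IHn] b w [|x A] //=; rewrite ?addr0 //.
case: w => [|c w] le_A /=.
  by rewrite IHn // slips_nil !addr0.
have [_|_] /= := eqVneq x c; last by rewrite IHn // addrA.
have [sl|nsl] := boolP (slack c w A); last first.
  by rewrite !andbF /= IHn // addrA.
case: A sl le_A => [|y A]; first by rewrite /slack.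
move=> /andP[/eqP[yc] hw]; rewrite {y}yc ltnS => le_A.
have le_A' : (size A <= n)%N by apply: ltnW.
rewrite slipsE //= doubleS -addn2 natrD.
case: b => /=; rewrite ?eqxx ?embedE //= ?negbK ?eqxx /=.
  rewrite -[X in altsum R false X]/(embed true w (c :: A)) embedE //= (IHn true) //=.
  ring.
rewrite -[X in _ + altsum R true X = _]/(embed true w (c :: A)) embedE //= (IHn false) //=.
ring.
Qed.
End Embedding.

(** * Weighted parses of a pair of binary strings *)

Notation letter := 'I_2.

Lemma letter_neq (x y c : letter) : x != c -> y != c -> x = y.
Proof.
by case: x y c => [[|[|?]] ?] [[|[|?]] ?] [[|[|?]] ?] // _ _; apply: val_inj.
Qed.

Lemma other_letter (p : letter) : exists q : letter, q != p.
Proof. by case: p => [[|[|//]] ?]; [exists ord_max|exists ord0]. Qed.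

Variant state : Type :=
  | Fresh of letter | Long of letter
  | InsA of letter | InsA2 of letter
  | InsB of letter | InsB1 of letter.

Section ParseWeight.
Variables (R : realFieldType) (r s : R).

Definition open_cost (x p : letter) : R := if x == p then s else 1.

(* Sum over the parses of a pair of strings, with a factor [r] for each match
   and [s] for each slip; a parse may stop anywhere, and [n] is fuel. The states are:
   [Fresh p], just after a match of [p];
   [Long p], the same when at least two letters of [A] were skipped before it;
   [InsA z], [InsA2 z], while skipping [z]'s in [A], one or at least two so far;
   [InsB z], while skipping [z]'s in [B];
   [InsB1 z], the same after [Long], when only one letter can be skipped. *)
Fixpoint parse_sum (n : nat) (st : state) (A B : seq letter) : R :=
  match n, A, B with
  | n'.+1, x :: A', y :: B' =>
    let hit st' := if x == y then r * parse_sum n' st' A' B' else 0 in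
    match st with
    | Fresh p => 1 + hit (Fresh x)
        + open_cost x p * parse_sum n' (InsA x) A' B
        + open_cost y p * parse_sum n' (InsB y) A B'
    | Long p => 1 + hit (Fresh x)
        + open_cost x p * parse_sum n' (InsA x) A' B
        + (if y == p then s * parse_sum n' (InsB y) A B'
           else parse_sum n' (InsB1 y) A B')
    | InsA z => if x == z then parse_sum n' (InsA2 z) A' B else hit (Fresh x)
    | InsA2 z => if x == z then parse_sum n' (InsA2 z) A' B else hit (Long x)
    | InsB z => if y == z then parse_sum n' (InsB z) A B' else hit (Fresh x)
    | InsB1 z => if y == z then 0 else hit (Fresh x)
    end
  | _, _, _ => 1
  end.

Hypotheses (r_ge0 : 0 <= r) (s_ge0 : 0 <= s) (s_le1 : s <= 1).

Lemma open_cost_ge0 x p : 0 <= open_cost x p.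
Proof. by rewrite /open_cost; case: ifP. Qed.

Lemma parse_sum_ge0 n st A B : 0 <= parse_sum n st A B.
Proof.
elim: n st A B => [|n IHn] st [|x A] [|y B] //=.
have hit_ge0 st' : 0 <= if x == y then r * parse_sum n st' A B else 0.
  by case: ifP => // _; rewrite mulr_ge0.
case: st => z; rewrite ?addr_ge0 ?mulr_ge0 ?open_cost_ge0 //; case: ifP => // _.
by rewrite mulr_ge0.
Qed.

Definition longest (w A B : seq letter) : Prop :=
  [/\ subseq w A, subseq w B &
      forall v, subseq v A -> subseq v B -> (size v <= size w)%N].

Lemma longest_cons c w A B : longest (c :: w) (c :: A) (c :: B) -> longest w A B.
Proof.
case=> /=; rewrite eqxx => sA sB sv; split=> // v vA vB.
by have := sv (c :: v); rewrite /= eqxx; apply.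
Qed.

Lemma longest_dropl x w A B :
  longest w (x :: A) B -> subseq w A -> longest w A B.
Proof.
case=> _ sB sv sA; split=> // v vA; apply: sv.
exact: subseq_trans vA (subseq_cons A x).
Qed.

Lemma longest_dropr y w A B :
  longest w A (y :: B) -> subseq w B -> longest w A B.
Proof.
case=> sA _ sv sB; split=> // v vA vB; apply: sv => //.
exact: subseq_trans vB (subseq_cons B y).
Qed.

Definition weight (l e : nat) : R := r ^+ l * s ^+ e.

(** Whether the match of [p] is a slip depends on what follows it, so its cost is charged one step
    later. The insertion states come after this payment and use [slips_weight]. *)
Definition slack_weight (p : letter) (w A B : seq letter) : R :=
  weight (size w) (slack p w A + slips w A + (slack p w B + slips w B)).

Definition slips_weight (w A B : seq letter) : R :=
  weight (size w) (slips w A + slips w B).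

Lemma weightS l e : weight l.+1 e = r * weight l e.
Proof. by rewrite /weight exprS mulrA. Qed.

Lemma weight_add l k e : weight l (k + e) = s ^+ k * weight l e.
Proof. by rewrite /weight exprD mulrCA. Qed.

Lemma weight0_le1 e : weight 0 e <= 1.
Proof. by rewrite /weight mul1r exprn_ile1. Qed.

(* After [Long p], the match of [p] and two of the letters [q] skipped in [A]
   before it are kept in the maximality condition. *)
Definition parse_spec (st : state) (w A B : seq letter) : Prop :=
  match st with
  | Fresh p => longest w A B
  | Long p => longest w A B /\
      exists2 q, q != p & longest (p :: w) [:: q, q, p & A] (p :: B)
  | InsA z => longest w (z :: A) B /\ 
     [/\ subseq w A, ohead w = ohead B & exists2 c, ohead w = Some c & c != z]
  | InsA2 z => longest w [:: z, z & A] B /\ 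
     [/\ subseq w A, ohead w = ohead B & exists2 c, ohead w = Some c & c != z]
  | InsB z => longest w A (z :: B) /\
     [/\ subseq w B, ohead w = ohead A & exists2 c, ohead w = Some c & c != z]
  | InsB1 z => longest w A (z :: B) /\
     [/\ subseq w B, ohead w = ohead A, ohead B <> Some z
       & exists2 c, ohead w = Some c & c != z]
  end.

Definition parse_lb (st : state) (w A B : seq letter) : R :=
  match st with
  | Fresh p | Long p => slack_weight p w A B
  | _ => slips_weight w A B
  end.

Lemma slack_hit (p c : letter) w A : slack p (c :: w) (c :: A) = false.
Proof. by rewrite /slack andbN. Qed.

Lemma slack_miss (p x c : letter) w A :
  x != c -> slack p (c :: w) (x :: A) = (x == p).
Proof.
move=> neq_xc; rewrite /slack; apply: andb_idr => /eqP[<-] /=.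
by apply: contra neq_xc => /eqP[->].
Qed.

Lemma slips_hit c (w A : seq letter) :
  slips (c :: w) (c :: A) = (slack c w A + slips w A)%N.
Proof. by rewrite /= eqxx. Qed.

Lemma slips_miss x c (w A : seq letter) :
  x != c -> slips (c :: w) (x :: A) = slips (c :: w) A.
Proof. by move=> /= /negPf ->. Qed.

Lemma slack_weight_hit p c w A B :
  slack_weight p (c :: w) (c :: A) (c :: B) = r * slack_weight c w A B.
Proof. by rewrite /slack_weight !slack_hit !slips_hit /= weightS. Qed.

Lemma slips_weight_hit c w A B :
  slips_weight (c :: w) (c :: A) (c :: B) = r * slack_weight c w A B.
Proof. by rewrite /slips_weight !slips_hit /= weightS. Qed.

Lemma open_costE (x p : letter) : s ^+ (x == p) = open_cost x p.
Proof. by rewrite /open_cost; case: eqP. Qed.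

Lemma slack_weight_missl p x c w A B : x != c ->
  slack_weight p (c :: w) (x :: A) (c :: B) =
  open_cost x p * slips_weight (c :: w) A (c :: B).
Proof.
move=> neq_xc; rewrite /slack_weight slack_hit slack_miss // slips_miss //.
by rewrite add0n -addnA weight_add open_costE.
Qed.

Lemma slack_weight_missr p y c w A B : y != c ->
  slack_weight p (c :: w) (c :: A) (y :: B) =
  open_cost y p * slips_weight (c :: w) (c :: A) B.
Proof.
move=> neq_yc; rewrite /slack_weight slack_hit slack_miss // [slips _ (y :: _)]slips_miss //.
by rewrite add0n addnCA weight_add open_costE.
Qed.

Lemma subseq_miss (x c : letter) w A :
  x != c -> subseq (c :: w) (x :: A) = subseq (c :: w) A.
Proof. by move=> neq_xc; rewrite /= eq_sym (negPf neq_xc). Qed.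

Lemma subseq_hit (c : letter) w A : subseq (c :: w) (c :: A) = subseq w A.
Proof. by rewrite /= eqxx. Qed.

(** Over two letters, two heads different from [c] coincide, and could be put in front of the word,
    against its maximality. *)
Lemma longest_hit c w x A y B :
  longest (c :: w) (x :: A) (y :: B) -> (x == c) || (y == c).
Proof.
case=> sA sB sv; apply/norP => -[xc yc]; have xy := letter_neq xc yc.
rewrite -xy in sB sv; rewrite !(subseq_miss _ _ xc) in sA sB.
have := sv [:: x, c & w]; rewrite ![subseq (x :: _) _]/= !eqxx => /(_ sA sB).
by rewrite /= ltnn.
Qed.

(* [q q p w] is longer than [p p w]: this is where maximality forbids two
   consecutive long insertions, first in [A] and then in [B]. *)
Lemma no_long_insertions (p q : letter) w A B : q != p ->
  longest [:: p, p & w] [:: q, q, p, p & A] [:: p, q, q & B] -> False.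
Proof.
move=> qp [sA sB sv]; have pq : p != q by rewrite eq_sym.
move: sA sB; rewrite !(subseq_miss _ _ qp) !subseq_hit !(subseq_miss _ _ qp).
move=> sA sB; have := sv [:: q, q, p & w].
rewrite !subseq_hit (subseq_miss _ _ pq) !subseq_hit sB.
by rewrite (subseq_trans sA (subseq_cons _ _)) /= ltnn => /(_ isT isT).
Qed.

(** After [Fresh] or [Long] an exhausted string forces an empty word, whose weight is a power of
    [s]; an insertion state requires a further match and is impossible here. *)
Lemma parse_lb_le1 st w A B : (A == [::]) || (B == [::]) ->
  parse_spec st w A B -> parse_lb st w A B <= 1.
Proof.
have long0 v : longest v A B -> (A == [::]) || (B == [::]) -> size v = 0%N.
  by case=> vA vB _ /orP[]/eqP AB; [move: vA|move: vB]; rewrite AB subseq0 => /eqP->.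
move=> AB; case: st => z /=.
- by move=> /long0/(_ AB); rewrite /slack_weight => ->; apply: weight0_le1.
- by case=> /long0/(_ AB) + _; rewrite /slack_weight => ->; apply: weight0_le1.
- case=> _ [wA wB [c wc _]]; case/orP: AB => /eqP AB; move: wA wB;
    by rewrite AB ?subseq0 ?wc // => /eqP wE; move: wc; rewrite wE.
- case=> _ [wA wB [c wc _]]; case/orP: AB => /eqP AB; move: wA wB;
    by rewrite AB ?subseq0 ?wc // => /eqP wE; move: wc; rewrite wE.
- case=> _ [wA wB [c wc _]]; case/orP: AB => /eqP AB; move: wA wB;
    by rewrite AB ?subseq0 ?wc // => /eqP wE; move: wc; rewrite wE.
- case=> _ [wA wB _ [c wc _]]; case/orP: AB => /eqP AB; move: wA wB;
    by rewrite AB ?subseq0 ?wc // => /eqP wE; move: wc; rewrite wE.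
Qed.

Lemma fresh_spec p c w x y A B : parse_spec (Fresh p) (c :: w) (x :: A) (y :: B) ->
  [\/ [/\ x = c, y = c & parse_spec (Fresh c) w A B],
      [/\ x != c, y = c & parse_spec (InsA x) (c :: w) A (y :: B)] |
      [/\ x = c, y != c & parse_spec (InsB y) (c :: w) (x :: A) B]].
Proof.
move=> lw; have := longest_hit lw; move: lw => /=.
have [->|xc] := eqVneq x c; have [->|yc] //= := eqVneq y c => lw _.
- by apply: Or31; split=> //; apply: longest_cons lw.
- apply: Or33; split=> //; split=> //; case: (lw) => _ wB _.
  by move: wB; rewrite (subseq_miss _ _ yc); split=> //; exists c; rewrite // eq_sym.
- apply: Or32; split=> //; split=> //; case: (lw) => wA _ _.
  by move: wA; rewrite (subseq_miss _ _ xc); split=> //; exists c; rewrite // eq_sym.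
Qed.

(** The parse that follows [w] is one of the nonnegative terms of the sum, and [parse_spec] is the
    invariant along it. Each step removes a letter, so the total length is enough fuel. *)
Lemma parse_sum_ge n st w A B : (size A + size B <= n)%N ->
  parse_spec st w A B -> parse_lb st w A B <= parse_sum n st A B.
Proof.
elim: n st w A B => [|n IHn] st w [|x A] [|y B] // szAB; try exact: parse_lb_le1.
have szl : (size A + size (y :: B) <= n)%N by rewrite -ltnS.
have szr : (size (x :: A) + size B <= n)%N by rewrite -ltnS -addnS.
have szlr : (size A + size B <= n)%N by apply: leq_trans szr; rewrite leq_add2r /=.
have sum_ge (v h a b : R) : 0 <= h -> 0 <= a -> 0 <= b ->
  [\/ v <= 1, v <= h, v <= a | v <= b] -> v <= 1 + h + a + b.
  by move=> h0 a0 b0 [] ?; lra.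
have hit_ge0 st' : 0 <= if x == y then r * parse_sum n st' A B else 0.
  by case: ifP => // _; rewrite mulr_ge0 ?parse_sum_ge0.
have fresh p w' : parse_spec (Fresh p) w' (x :: A) (y :: B) ->
    slack_weight p w' (x :: A) (y :: B) <= parse_sum n.+1 (Fresh p) (x :: A) (y :: B).
  move=> spec; rewrite [parse_sum _ _ _ _]/=; apply: sum_ge => //.
  - by rewrite mulr_ge0 ?open_cost_ge0 ?parse_sum_ge0.
  - by rewrite mulr_ge0 ?open_cost_ge0 ?parse_sum_ge0.
  case: w' spec => [|c w'] spec; first by apply: Or41; exact: weight0_le1.
  have [[xc yc sp]|[xc yc sp]|[xc yc sp]] := fresh_spec spec.
  - subst x y; rewrite eqxx slack_weight_hit; apply: Or42; apply: ler_wpM2l => //.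
    exact: (IHn _ _ _ _ szlr sp).
  - subst y; rewrite slack_weight_missl //; apply: Or43.
    by apply: ler_wpM2l; [exact: open_cost_ge0|exact: (IHn _ _ _ _ szl sp)].
  - subst x; rewrite slack_weight_missr //; apply: Or44.
    by apply: ler_wpM2l; [exact: open_cost_ge0|exact: (IHn _ _ _ _ szr sp)].
case: st => p; first exact: fresh.
- rewrite [parse_sum _ _ _ _]/= [parse_lb _ _ _ _]/=.
  case=> lw [q qp lq].
  have [yp|yp] := eqVneq y p.
    by have := fresh p w lw; rewrite /= yp /open_cost eqxx.
  apply: sum_ge => //; rewrite ?mulr_ge0 ?open_cost_ge0 ?parse_sum_ge0 //.
  case: w lw lq => [|c w] lw lq; first by apply: Or41; exact: weight0_le1.
  have [[xc yc sp]|[xc yc sp]|[xc yc sp]] := fresh_spec (lw : parse_spec (Fresh p) _ _ _).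
  + subst x y; rewrite eqxx slack_weight_hit; apply: Or42; apply: ler_wpM2l => //.
    exact: (IHn _ _ _ _ szlr sp).
  + subst y; rewrite slack_weight_missl //; apply: Or43.
    by apply: ler_wpM2l; [exact: open_cost_ge0|exact: (IHn _ _ _ _ szl sp)].
  + subst x; rewrite slack_weight_missr // /open_cost (negPf yp) mul1r; apply: Or44.
    apply: (IHn (InsB1 y)) => //; case: sp => l1 [l2 l3 l4]; split=> //; split=> // hB.
    (* Over two letters, a second skipped [y] in [B] would turn [lq] into the pattern excluded by
       [no_long_insertions]. *)
    have yq : y = q by apply: letter_neq yp qp.
    have cp : c = p by apply: (@letter_neq _ _ y); rewrite eq_sym.
    subst q c; case: B hB lq {IHn szAB szl szr szlr hit_ge0 fresh lw l1 l2 l3} => // _ B [->].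
    exact: no_long_insertions.
- rewrite [parse_sum _ _ _ _]/= [parse_lb _ _ _ _]/=.
  case=> lw [wA wB [c wc cp]].
  case: w wc lw wA wB => // _ w [->] lw wA [yc].
  subst y; have [xp|xp] := eqVneq x p.
    subst x; have pc : p != c by rewrite eq_sym.
    rewrite /slips_weight slips_miss //; apply: (IHn (InsA2 p)) => //.
    rewrite (subseq_miss _ _ pc) in wA.
    by split=> //; split=> //; exists c.
  have xc : x = c by apply: letter_neq xp cp.
  subst x; rewrite eqxx slips_weight_hit; apply: ler_wpM2l => //.
  apply: (IHn (Fresh c)) => //=.
  exact: longest_cons (longest_dropl lw wA).
- rewrite [parse_sum _ _ _ _]/= [parse_lb _ _ _ _]/=.
  case=> lw [wA wB [c wc cp]].
  case: w wc lw wA wB => // _ w [->] lw wA [yc].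
  subst y; have [xp|xp] := eqVneq x p.
    subst x; have pc : p != c by rewrite eq_sym.
    rewrite /slips_weight slips_miss //; apply: (IHn (InsA2 p)) => //.
    have wA' := wA; rewrite (subseq_miss _ _ pc) in wA'.
    split; last by split=> //; exists c.
    (* One of three skipped letters is forgotten, so that the state always remembers exactly two. *)
    by apply: longest_dropl lw _; rewrite (subseq_miss _ _ pc).
  have xc : x = c by apply: letter_neq xp cp.
  subst x; rewrite eqxx slips_weight_hit; apply: ler_wpM2l => //.
  apply: (IHn (Long c)) => //=; split; last by exists p; rewrite // eq_sym.
  have pc : p != c by rewrite eq_sym.
  apply/longest_cons/longest_dropl; last exact: wA.
  by apply: longest_dropl lw _; rewrite (subseq_miss _ _ pc).
- rewrite [parse_sum _ _ _ _]/= [parse_lb _ _ _ _]/=.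
  case=> lw [wB wA [c wc cp]].
  case: w wc lw wA wB => // _ w [->] lw [xc] wB.
  subst x; have pc : p != c by rewrite eq_sym.
  have [yp|yp] := eqVneq y p.
    subst y; rewrite /slips_weight [slips _ (p :: _)]slips_miss //.
    have wB' := wB; rewrite (subseq_miss _ _ pc) in wB'.
    apply: (IHn (InsB p)) => //; split; last by split=> //; exists c.
    exact: longest_dropr lw wB.
  have yc : y = c by apply: letter_neq yp cp.
  subst y; rewrite eqxx slips_weight_hit; apply: ler_wpM2l => //.
  apply: (IHn (Fresh c)) => //=.
  exact: longest_cons (longest_dropr lw wB).
- rewrite [parse_sum _ _ _ _]/= [parse_lb _ _ _ _]/=.
  case=> lw [wB wA yp [c wc cp]].
  case: w wc lw wA wB => // _ w [->] lw [xc] wB.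
  subst x; case: ifPn => [/eqP yp'|{}yp]; first by case: yp; rewrite yp'.
  have yc : y = c by apply: letter_neq yp cp.
  subst y; rewrite eqxx slips_weight_hit; apply: ler_wpM2l => //.
  apply: (IHn (Fresh c)) => //=.
  exact: longest_cons (longest_dropr lw wB).
Qed.

End ParseWeight.

(** * Averages over uniform binary strings and the bound on the transfer operator *)

Section Mean.
Variable R : realFieldType.
Implicit Types (n a b : nat) (f g : seq letter -> R).
Implicit Types (F G : seq letter -> seq letter -> R).

Definition mean n f : R := (2 ^+ n)^-1 * \sum_(t : n.-tuple letter) f t.

Lemma mean_ext n f g : (forall A, size A = n -> f A = g A) -> mean n f = mean n g.
Proof. by move=> fg; congr (_ * _); apply: eq_bigr => t _; rewrite fg ?size_tuple. Qed.

Lemma mean_le n f g :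
  (forall A, size A = n -> f A <= g A) -> mean n f <= mean n g.
Proof.
move=> fg; rewrite ler_wpM2l ?invr_ge0 ?exprn_ge0 //.
by apply: ler_sum => t _; rewrite fg ?size_tuple.
Qed.

Lemma meanD n f g : mean n (fun A => f A + g A) = mean n f + mean n g.
Proof. by rewrite /mean big_split mulrDr. Qed.

Lemma meanZ n c f : mean n (fun A => c * f A) = c * mean n f.
Proof. by rewrite /mean -mulr_sumr mulrCA. Qed.

Lemma mean_cst n c : mean n (fun=> c) = c.
Proof.
rewrite /mean sumr_const card_tuple card_ord -[c *+ _]mulr_natl natrX mulKf ?expf_neq0 ?pnatr_eq0 //.
Qed.

Lemma meanD_cst n f c : mean n (fun A => f A + c) = mean n f + c.
Proof. by rewrite meanD mean_cst. Qed.

Lemma mean_sum n (I : finType) (P : pred I) (f : I -> seq letter -> R) :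
  mean n (fun A => \sum_(i | P i) f i A) = \sum_(i | P i) mean n (f i).
Proof. by rewrite /mean exchange_big mulr_sumr. Qed.

Lemma mean_ge0 n f : (forall A, size A = n -> 0 <= f A) -> 0 <= mean n f.
Proof. by move=> f0; rewrite -(mean_cst n 0); apply: mean_le. Qed.

Lemma big_letter (p q : letter) (h : letter -> R) :
  q != p -> \sum_x h x = h p + h q.
Proof.
move=> qp; rewrite (bigD1 p) //= (bigD1 q) //= big1 ?addr0 // => x /andP[xp xq].
by move: (letter_neq xp qp) xq => ->; rewrite eqxx.
Qed.

Lemma meanS n f (p q : letter) : q != p ->
  mean n.+1 f = (mean n (fun A => f (p :: A)) + mean n (fun A => f (q :: A))) / 2.
Proof.
move=> qp; pose cons_t (u : letter * n.-tuple letter) := cons_tuple u.1 u.2.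
have bij : bijective cons_t.
  exists (fun t => (thead t, behead_tuple t)) => [[x t]|t] /=.
    by congr (_, _); apply: val_inj.
  by apply: val_inj; case/tupleP: t => x t.
rewrite /mean (reindex cons_t) /=; last exact: onW_bij.
rewrite -(pair_big xpredT xpredT (fun x (t : n.-tuple letter) => f (x :: t))) /=.
by rewrite (big_letter _ qp) exprS; field; rewrite ?expf_neq0 ?pnatr_eq0.
Qed.

Definition mean2 a b F : R := mean a (fun A => mean b (F A)).

Lemma mean2_ext a b F G :
  (forall A B, size A = a -> size B = b -> F A B = G A B) -> mean2 a b F = mean2 a b G.
Proof. by move=> FG; apply: mean_ext => A sA; apply: mean_ext => B; exact: FG. Qed.

Lemma mean2_le a b F G :
  (forall A B, size A = a -> size B = b -> F A B <= G A B) -> mean2 a b F <= mean2 a b G.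
Proof. by move=> FG; apply: mean_le => A sA; apply: mean_le => B; exact: FG. Qed.

Lemma mean2D a b F G : mean2 a b (fun A B => F A B + G A B) = mean2 a b F + mean2 a b G.
Proof. by rewrite /mean2 -meanD; apply: mean_ext => A _; rewrite meanD. Qed.

Lemma mean2Z a b c F : mean2 a b (fun A B => c * F A B) = c * mean2 a b F.
Proof. by rewrite /mean2 -meanZ; apply: mean_ext => A _; rewrite meanZ. Qed.

Lemma mean2_cst a b c : mean2 a b (fun _ _ => c) = c.
Proof. by rewrite /mean2 mean_cst mean_cst. Qed.

Lemma mean2C a b F : mean2 a b F = mean2 b a (fun B A => F A B).
Proof.
rewrite /mean2 /mean -!mulr_sumr mulrCA; congr (_ * (_ * _)).
exact: exchange_big.
Qed.

Lemma mean2Sl a b F (p q : letter) : q != p -> mean2 a.+1 b F =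
  (mean2 a b (fun A => F (p :: A)) + mean2 a b (fun A => F (q :: A))) / 2.
Proof. exact: meanS. Qed.

Lemma mean2Sr a b F (p q : letter) : q != p -> mean2 a b.+1 F =
  (mean2 a b (fun A B => F A (p :: B)) + mean2 a b (fun A B => F A (q :: B))) / 2.
Proof.
move=> qp; rewrite mean2C (mean2Sl _ _ _ qp).
by rewrite ![mean2 b a _]mean2C.
Qed.

Definition match_factor : R := 201 / 200.
Definition slip_factor : R := 1 / 100.
Let r := match_factor.
Let s := slip_factor.

(* A supersolution of the recursion for the mean of [parse_sum]: at [r = 1] and
   [s = 0], and without the constant term, [Fresh] = 1 and [Long] = 7/8 already
   satisfy it strictly (63/64 and 55/64), which leaves room for the chosen values. *)
Definition state_bound (st : state) : R :=
  match st with
  | Fresh _ => 1000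
  | Long _ => 875
  | InsA _ => r * 1875 / 4
  | InsA2 _ => r * 875 / 2
  | InsB _ => r * 500
  | InsB1 _ => r * 250
  end.

Lemma mean_parse_sum n st a b :
  mean2 a b (parse_sum r s n st) <= state_bound st.
Proof.
have bound_ge1 st' : 1 <= state_bound st' by rewrite /state_bound /r /match_factor; case: st' => ?; lra.
elim: n st a b => [|n IHn] st a b.
  by rewrite (@mean2_ext _ _ _ (fun _ _ => 1)) ?mean2_cst.
case: a => [|a].
  rewrite (@mean2_ext _ _ _ (fun _ _ => 1)) ?mean2_cst //.
  by move=> A B /size0nil -> _.
case: b => [|b].
  rewrite (@mean2_ext _ _ _ (fun _ _ => 1)) ?mean2_cst //.
  by move=> [|? ?] B _ /size0nil ->.
(* A call that leaves [B] intact occurs once for each first letter of [B]; together the two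
   occurrences form a mean over strings of length [b.+1], to which [IHn] applies. *)
have IHA st' (p q : letter) : q != p ->
    (mean2 a b (fun A B => parse_sum r s n st' A (p :: B)) +
     mean2 a b (fun A B => parse_sum r s n st' A (q :: B))) / 2 <= state_bound st'.
  by move=> qp; rewrite -mean2Sr.
have IHB st' (p q : letter) : q != p ->
    (mean2 a b (fun A B => parse_sum r s n st' (p :: A) B) +
     mean2 a b (fun A B => parse_sum r s n st' (q :: A) B)) / 2 <= state_bound st'.
  by move=> qp; rewrite -mean2Sl.
have [q qp] := other_letter
  (let: (Fresh p | Long p | InsA p | InsA2 p | InsB p | InsB1 p) := st in p).
rewrite (mean2Sl _ _ _ qp) !(mean2Sr _ _ _ qp).
case: st qp => p qp; have pq : p != q by rewrite eq_sym.
all: rewrite /= /open_cost ?eqxx ?(negPf qp) ?(negPf pq).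
all: rewrite ?(mean2D, mean2Z, mean2_cst).
all: move: (IHn (Fresh p) a b) (IHn (Fresh q) a b) (IHn (Long q) a b)
  (IHA (InsA p) p q qp) (IHA (InsA q) p q qp) (IHA (InsA2 p) p q qp)
  (IHB (InsB p) p q qp) (IHB (InsB q) p q qp) (IHB (InsB1 q) p q qp).
(* The bounds of the insertion states solve their recursions exactly; only [Fresh] and [Long] use
   the room left by the constants. *)
all: by rewrite /state_bound /r /s /match_factor /slip_factor => ? ? ? ? ? ? ? ? ?; lra.
Qed.
End Mean.

(** * Independence and common subsequences built around a central string *)

Section Expectation.
Variable R : realType.

Lemma strings_probE n d (A : strings n 2 d) : strings_prob R A = ((2 ^+ n)^-1) ^+ d.
Proof.
rewrite /strings_prob (eq_bigr (fun=> (2 ^+ n)^-1)) ?prodr_const ?card_ord // => i _.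
by rewrite prodr_const card_ord exprVn.
Qed.

Lemma expect_prod n d (F : 'I_d -> seq letter -> R) :
  \sum_(A : strings n 2 d) strings_prob R A * \prod_(i < d) F i (A i) =
  \prod_(i < d) mean n (F i).
Proof.
rewrite /mean big_split /= prodr_const card_ord bigA_distr_bigA mulr_sumr.
by apply: eq_bigr => A _; rewrite strings_probE.
Qed.

Lemma strings_prob_sum n d : \sum_(A : strings n 2 d) strings_prob R A = 1.
Proof.
have := @expect_prod n d (fun _ _ => 1); rewrite [RHS]big1 => [<-|i _].
  by apply: eq_bigr => A _; rewrite big1 ?mulr1.
by rewrite mean_cst.
Qed.

Lemma mean_indic n (f : seq letter -> R) :
  mean n f = \sum_(a : n.-tuple letter) f a * mean n (fun B => (B == a)%:R).
Proof.
rewrite {1}/mean mulr_sumr; apply: eq_bigr => a _; rewrite mulrC; congr (_ * _).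
rewrite /mean (bigD1 a) //= eqxx big1 ?addr0 ?mulr1 // => t ta.
by rewrite (_ : _ == _ = false) //; exact: negbTE.
Qed.

(** Given the centre [A ord0], the [k] factors are independent with the same law, so their
    conditional mean is a [k]-th power. *)
Lemma expect_star n k (G : seq letter -> seq letter -> R) :
  \sum_(A : strings n 2 k.+1)
    strings_prob R A * \prod_(j < k) G (A ord0) (A (lift ord0 j)) =
  mean n (fun a => mean n (G a) ^+ k).
Proof.
(* The indicator of [A ord0 = a] turns conditioning on the centre into one more independent
   factor. *)
pose F (a : n.-tuple letter) (i : 'I_k.+1) (B : seq letter) : R :=
  if unlift ord0 i is Some _ then G a B else (B == a)%:R.
transitivity (\sum_(a : n.-tuple letter) \sum_(A : strings n 2 k.+1)
    strings_prob R A * \prod_(i < k.+1) F a i (A i)); last first.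
  rewrite mean_indic; apply: eq_bigr => a _; rewrite expect_prod big_ord_recl mulrC.
  congr (_ * _); last by rewrite /F unlift_none.
  rewrite (eq_bigr (fun=> mean n (G a))) ?prodr_const ?card_ord // => j _.
  by rewrite /F liftK.
rewrite exchange_big; apply: eq_bigr => A _; rewrite (bigD1 (A ord0)) //=.
rewrite [X in _ + X]big1 ?addr0 => [|a aA].
  rewrite big_ord_recl {1}/F unlift_none eqxx mul1r; congr (_ * _).
  by apply: eq_bigr => j _; rewrite /F liftK.
by rewrite big_ord_recl {1}/F unlift_none val_eqE eq_sym (negPf aA) mul0r mulr0.
Qed.

Lemma mask_sub (m1 m2 : bitseq) (s : seq letter) :
  size m1 = size s -> size m2 = size s ->
  (forall i, nth false m1 i -> nth false m2 i) ->
  subseq (mask m1 s) (mask m2 s).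
Proof.
elim: s m1 m2 => [|x s IHs] [|b1 m1] [|b2 m2] //= [sz1] [sz2] m12.
have {}IHs := IHs m1 m2 sz1 sz2 (fun i => m12 i.+1).
have := m12 0%N; case: b1 {m12} => [/(_ isT) /= ->|_] /=; first by rewrite eqxx.
case: b2 => //.
exact: (subseq_trans IHs (subseq_cons (mask m2 s) x)).
Qed.

Lemma count_nthE (m : bitseq) : count id m = (\sum_(i < size m) nth false m i)%N.
Proof. by elim: m => [|b m IHm] /=; rewrite ?big_ord0 // big_ord_recl /= IHm. Qed.

Lemma altsum_nthE b (m : bitseq) :
  altsum R b m = \sum_(i < size m) (-1) ^+ (b + i) * (nth false m i)%:R.
Proof.
elim: m b => [|x m IHm] b /=; first by rewrite big_ord0.
rewrite big_ord_recl /= addn0 IHm; congr (_ + _); apply: eq_bigr => i _.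
by rewrite -[in LHS]signr_odd -[in RHS]signr_odd !oddD /=; case: b; case: (odd i).
Qed.

(* [M A B] marks letters of [A] forming a common subsequence of [A] and [B]; the
   letters of [A] marked for every other string form a common subsequence. *)
Lemma expectation_lcs_star n k (M : seq letter -> seq letter -> bitseq) :
  (forall A B, size A = n -> size B = n ->
     size (M A B) = n /\ subseq (mask (M A B) A) B) ->
  \sum_(i < n) mean n (fun A => mean n (fun B => (nth false (M A B) i)%:R) ^+ k)
    <= expectation_lcs R n 2 k.+1.
Proof.
move=> MP; under eq_bigr do rewrite -expect_star.
rewrite exchange_big; apply: ler_sum => A _; rewrite -mulr_sumr ler_wpM2l //.
  by rewrite strings_probE exprn_ge0 // invr_ge0 exprn_ge0.
pose all_marked i := [forall j : 'I_k, nth false (M (A ord0) (A (lift ord0 j))) i].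
pose m := mkseq all_marked n.
have sz_m : size m = size (A ord0) by rewrite size_mkseq size_tuple.
have -> : \sum_(i < n) \prod_(j < k) (nth false (M (A ord0) (A (lift ord0 j))) i)%:R =
    (size (mask m (A ord0)))%:R :> R.
  rewrite size_mask // count_nthE size_mkseq natr_sum; apply: eq_bigr => i _.
  rewrite nth_mkseq //; have [/forallP all1|] := boolP (all_marked i).
    by rewrite big1 // => j _; rewrite all1.
  by case/forallPn => j /negPf nj; rewrite (bigD1 j) //= nj mul0r.
rewrite ler_nat; apply: lcs_max => //; apply/forallP => i.
have [j ->|->] := unliftP ord0 i; last exact: mask_subseq.
have [szM subM] := MP (A ord0) (A (lift ord0 j)) (size_tuple _) (size_tuple _).
apply: subseq_trans subM; apply: mask_sub; rewrite ?size_tuple //.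
move=> l; have [ln|nl] := ltnP l n; last by rewrite nth_default ?size_mkseq.
by rewrite nth_mkseq // => /forallP.
Qed.

Lemma common_word_exists (A B : seq letter) : exists w, longest w A B /\
  size w = lcs (fun i : 'I_2 => if i == ord0 then A else B).
Proof.
have [w /forallP cw szw] := lcs_attained (fun i : 'I_2 => if i == ord0 then A else B).
exists w; split=> //; split=> [||v vA vB]; first exact: (cw ord0).
  exact: (cw (lift ord0 ord0)).
by rewrite szw; apply: lcs_max => //; apply/forallP => i; case: ifP.
Qed.

Definition common_word A B := projT1 (cid (common_word_exists A B)).

Lemma common_word_longest A B : longest (common_word A B) A B.
Proof. by rewrite /common_word; case: cid => w []. Qed.

Lemma expectation_lcs2 n :
  expectation_lcs R n 2 2 = mean2 n n (fun A B => (size (common_word A B))%:R).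
Proof.
rewrite /mean2 -(expect_star n 1 (fun A B => (size (common_word A B))%:R)).
apply: eq_bigr => A _; rewrite big_ord1; congr (_ * _%:R).
rewrite /common_word; case: cid => w [_ /= ->]; congr lcs; apply/funext => i.
by case: (unliftP ord0 i) => [j|] -> //; rewrite (ord1 j).
Qed.

End Expectation.

(** * A quantitative Jensen inequality for powers *)

Section PowerMean.
Variable R : realType.

(** Convexity: the power lies above its tangent at [x]. Jensen's inequality is applied in this
    form. *)
Lemma expr_tangent k (x p : R) : 0 <= x -> 0 <= p ->
  x ^+ k.+1 + k.+1%:R * x ^+ k * (p - x) <= p ^+ k.+1.
Proof.
move=> x0 p0; elim: k => [|k IHk]; first by rewrite !expr1 expr0; lra.
rewrite [p ^+ _]exprS; apply: le_trans (ler_wpM2l p0 IHk).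
rewrite -subr_ge0 [X in 0 <= X](_ : _ = k.+1%:R * x ^+ k * (p - x) ^+ 2).
  by rewrite mulr_ge0 ?sqr_ge0 // mulr_ge0 ?exprn_ge0.
by rewrite -!(natr1 k.+1) !exprS; ring.
Qed.

(** Origin of the strict gain: [m + h] and [m - h] will be the average marking probabilities at even
    and at odd positions. *)
Lemma expr_sum_diff k (m h : R) : `|h| <= m ->
  m ^+ k.+2 + h ^+ 2 * m ^+ k <= ((m + h) ^+ k.+2 + (m - h) ^+ k.+2) / 2.
Proof.
rewrite ler_norml => /andP[hm mh].
(* The second inequality is the cross term that appears when the exponent is raised by one. *)
suff [//] : m ^+ k.+2 + h ^+ 2 * m ^+ k <= ((m + h) ^+ k.+2 + (m - h) ^+ k.+2) / 2 /\
    0 <= h * ((m + h) ^+ k.+2 - (m - h) ^+ k.+2).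
have m0 : 0 <= m by lra.
elim: k => [|k [IH1 IH2]].
  rewrite expr0 !expr2; split; first by lra.
  rewrite (_ : _ * _ = 4 * m * h ^+ 2); last by ring.
  by rewrite mulr_ge0 ?sqr_ge0 ?mulr_ge0.
set X := (m + h) ^+ k.+2 in IH1 IH2 *; set Y := (m - h) ^+ k.+2 in IH1 IH2 *.
rewrite !(exprS _ k.+2) -/X -/Y; split.
  rewrite (_ : _ + _ = m * (m ^+ k.+2 + h ^+ 2 * m ^+ k)); last by rewrite !exprS; ring.
  apply: le_trans (ler_wpM2l m0 IH1) _; rewrite -subr_ge0.
  by rewrite (_ : _ - _ = h * (X - Y) / 2) ?divr_ge0 //; field.
have X0 : 0 <= X by rewrite exprn_ge0 //; lra.
have Y0 : 0 <= Y by rewrite exprn_ge0 //; lra.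
rewrite (_ : _ * _ = m * (h * (X - Y)) + h ^+ 2 * (X + Y)); last by ring.
by rewrite addr_ge0 // mulr_ge0 ?sqr_ge0 // addr_ge0.
Qed.

Lemma sum_alternating N (a b : R) :
  \sum_(i < N.*2) (a + (-1) ^+ i * b) = N.*2%:R * a.
Proof.
elim: N => [|N IHN]; first by rewrite big_ord0 mul0r.
rewrite doubleS !big_ord_recr /= IHN -[in X in _ + X]signr_odd /= odd_double.
rewrite -signr_odd odd_double expr0 expr1 -[in RHS]addn2 natrD; ring.
Qed.

Lemma expr_alternating i k (m h : R) :
  (m + (-1) ^+ i * h) ^+ k =
  ((m + h) ^+ k + (m - h) ^+ k) / 2 + (-1) ^+ i * (((m + h) ^+ k - (m - h) ^+ k) / 2).
Proof. by rewrite -signr_odd; case: (odd i); rewrite ?expr0 ?expr1 ?mulN1r ?mul1r; field. Qed.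

(** The [q i] average to [m + h] over even and to [m - h] over odd indices, so the first-order terms
    of the tangents cancel. *)
Lemma sum_expr_alternating N k (q : 'I_(N.*2) -> R) (m h : R) :
  \sum_(i < N.*2) q i = N.*2%:R * m -> \sum_(i < N.*2) (-1) ^+ i * q i = N.*2%:R * h ->
  \sum_(i < N.*2) ((m + (-1) ^+ i * h) ^+ k.+1 +
          k.+1%:R * (m + (-1) ^+ i * h) ^+ k * (q i - (m + (-1) ^+ i * h))) =
  N.*2%:R * (((m + h) ^+ k.+1 + (m - h) ^+ k.+1) / 2).
Proof.
move=> qm qh; rewrite big_split /=.
under eq_bigr do rewrite expr_alternating.
rewrite sum_alternating -[RHS]addr0; congr (_ + _).
set U := ((m + h) ^+ k + (m - h) ^+ k) / 2.
set V := ((m + h) ^+ k - (m - h) ^+ k) / 2.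
transitivity (k.+1%:R * (U * (\sum_(i < N.*2) q i) + V * (\sum_(i < N.*2) (-1) ^+ i * q i)
    - \sum_(i < N.*2) ((U * m + V * h) + (-1) ^+ i * (U * h + V * m)))).
  rewrite !mulr_sumr -big_split /= -sumrB mulr_sumr; apply: eq_bigr => i _.
  rewrite expr_alternating -/U -/V -signr_odd.
  by case: (odd i); rewrite ?expr0 ?expr1; ring.
by rewrite sum_alternating qm qh; ring.
Qed.

(** Jensen's inequality with one tangent point per parity class. The length is even so that both
    classes have the same size. *)
Lemma star_gain N k (M : seq letter -> seq letter -> bitseq) (m h : R) :
  let n := N.*2 in
  (forall A B, size A = n -> size B = n ->
     size (M A B) = n /\ subseq (mask (M A B) A) B) ->
  mean2 n n (fun A B => (count id (M A B))%:R) = n%:R * m ->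
  mean2 n n (fun A B => altsum R false (M A B)) = n%:R * h ->
  n%:R * (m ^+ k.+2 + h ^+ 2 * m ^+ k) <= expectation_lcs R n 2 k.+3.
Proof.
move=> n MP mE hE; have [->|n_gt0] := posnP n.
  rewrite mul0r; apply: sumr_ge0 => A _; rewrite mulr_ge0 // strings_probE.
  by rewrite exprn_ge0 // invr_ge0 exprn_ge0.
pose q (i : 'I_n) : R := mean2 n n (fun A B => (nth false (M A B) i)%:R).
have q0 i : 0 <= q i by apply: mean_ge0 => A _; apply: mean_ge0.
have qm : \sum_i q i = n%:R * m.
  rewrite -mE /q /mean2 -mean_sum; apply: mean_ext => A szA; rewrite -mean_sum.
  apply: mean_ext => B szB; have [szM _] := MP A B szA szB.
  by rewrite count_nthE szM natr_sum.
have qh : \sum_(i < n) (-1) ^+ i * q i = n%:R * h.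
  rewrite -hE /q /mean2; under eq_bigr do rewrite -meanZ.
  rewrite -mean_sum; apply: mean_ext => A szA; under eq_bigr do rewrite -meanZ.
  rewrite -mean_sum; apply: mean_ext => B szB; have [szM _] := MP A B szA szB.
  by rewrite altsum_nthE szM.
have hm : `|h| <= m.
  rewrite -(@ler_pM2l _ n%:R) ?ltr0n // -[X in X * `|_|]ger0_norm // -normrM -qm -qh.
  apply: le_trans (ler_norm_sum _ _ _) _; apply: ler_sum => i _.
  by rewrite normrM normrX normrN1 expr1n mul1r ger0_norm.
apply: le_trans _ (expectation_lcs_star R k.+2 MP).
apply: le_trans (ler_wpM2l _ (expr_sum_diff k hm)) _ => //.
rewrite -(sum_expr_alternating k.+1 qm qh); apply: ler_sum => i _.
set x := m + (-1) ^+ i * h.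
have x0 : 0 <= x.
  move: hm; rewrite ler_norml /x -signr_odd => /andP[? ?].
  by case: (odd i); rewrite ?expr0 ?expr1; lra.
rewrite /q /mean2; set p := fun A => mean n (fun B => (nth false (M A B) i)%:R).
apply: le_trans _ (mean_le (f := fun A => k.+2%:R * x ^+ k.+1 * (p A - x) + x ^+ k.+2) _).
  rewrite (meanD_cst n (fun A => k.+2%:R * x ^+ k.+1 * (p A - x))).
  by rewrite (meanZ n _ (fun A => p A - x)) (meanD_cst n p) addrC.
by move=> A _; rewrite addrC; apply: expr_tangent => //; apply: mean_ge0.
Qed.
End PowerMean.

(** * Longest common subsequences have linearly many slips on average *)

Section Slips.
Variable R : realType.

(** The mean of [r ^+ size w * s ^+ e], with [e] the number of slips up to a constant, is bounded;
    since [r > 1] and [s < 1], taking exponents shows that long words need many slips. *)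
Lemma slips_linear : exists2 c : R, 0 < c &
  exists C : R, forall n, c * expectation_lcs R n 2 2 - C <=
    mean2 n n (fun A B => (slips (common_word A B) A)%:R) +
    mean2 n n (fun A B => (slips (common_word A B) B)%:R).
Proof.
pose r := match_factor R; pose s := slip_factor R.
have r_gt1 : 1 < r by rewrite /r /match_factor; lra.
have s_lt1 : 0 < s < 1 by rewrite /s /slip_factor; lra.
have lnr : 0 < ln r by apply: ln_gt0.
have lns : 0 < - ln s by rewrite oppr_gt0 ln_lt0.
have s_ge0 : 0 <= s by case/andP: s_lt1 => /ltW.
exists (ln r / - ln s); first exact: divr_gt0.
(* [1000] is [state_bound] at [Fresh]; [2] pays for the two slacks of the fictitious match of [ord0]
   before the first letter. *)
exists (1000 / - ln s + 2) => n; rewrite expectation_lcs2.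
set S1 := mean2 n n _ ; set S2 := mean2 n n _; set S3 := mean2 n n _.
suff : ln r * S1 <= 1000 + - ln s * (S2 + S3 + 2).
  rewrite -(@ler_pM2r _ (- ln s)^-1) ?invr_gt0 // mulrDl [X in _ + X]mulrAC divff ?gt_eqF //.
  by rewrite mul1r mulrAC; lra.
have := @mean_parse_sum R (n + n) (Fresh ord0) n n.
rewrite -/r -/s /= => le_1000; rewrite -lerBlDr; apply: le_trans _ le_1000.
rewrite (_ : _ - _ = mean2 n n (fun A B => ln r * (size (common_word A B))%:R +
    (ln s * ((slips (common_word A B) A)%:R + (slips (common_word A B) B)%:R) + ln s * 2))); last first.
  rewrite mean2D mean2Z mean2D mean2Z mean2D mean2_cst -/S1 -/S2 -/S3; lra.
apply: mean2_le => A B szA szB; set w := common_word A B.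
apply: le_trans (parse_sum_ge (st := Fresh ord0) (w := w) _ _ _ _ _);
  rewrite ?szA ?szB ?(ltW r_gt1) //; [|lra..|exact: common_word_longest].
rewrite /= /slack_weight /weight; set e := (_ + _)%N.
have e_le : (e <= slips w A + slips w B + 2)%N.
  by rewrite /e; case: slack; case: slack; lia.
have -> : r ^+ size w * s ^+ e = expR (ln r *+ size w + ln s *+ e).
  rewrite -!lnXn ?(lt_trans _ r_gt1) ?expRD; [|by case/andP: s_lt1..].
  by rewrite !lnK // posrE exprn_gt0 ?(lt_trans _ r_gt1) //; case/andP: s_lt1.
apply: le_trans (expR_ge1Dx _).
rewrite -[ln r *+ _]mulr_natr -[ln s *+ _]mulr_natr.
move: e_le; rewrite -(@ler_nat R) !natrD => e_le.
have ln_s0 : ln s <= 0 by rewrite -oppr_ge0 ltW.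
by have := ler_wnM2l ln_s0 e_le; rewrite !mulrDr; lra.
Qed.
End Slips.

(** * Existence of the limits, and the gain in the limit *)

Section Limit.
Variable R : realType.

Lemma superadditiveM (u : nat -> R) : (forall n, 0 <= u n) ->
  (forall m n, u m + u n <= u (m + n)%N) ->
  forall q m, q%:R * u m <= u (q * m)%N.
Proof.
move=> u0 uD; elim=> [|q IHq] m; first by rewrite mul0r.
by rewrite mulSn -natr1 mulrDl mul1r addrC; apply: le_trans (uD _ _); rewrite lerD2l.
Qed.

(** Fekete's lemma: the limit is the supremum of the ratios. *)
Lemma superadditive_is_cvg (u : nat -> R) : (forall n, 0 <= u n <= n%:R) ->
  (forall m n, u m + u n <= u (m + n)%N) -> cvgn (fun n => u n / n%:R).
Proof.
move=> u_bound uD; have u0 n : 0 <= u n by case/andP: (u_bound n).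
pose E : set R := range (fun n => u n / n%:R).
have ub_E : ubound E 1.
  move=> _ [[|n] _ <-]; first by rewrite invr0 mulr0.
  by rewrite ler_pdivrMr ?ltr0n // mul1r; case/andP: (u_bound n.+1).
have sup_E : has_sup E by split; [exists (u 0%N / 0%:R), 0%N | exists 1].
apply: (@cvgP _ _ (sup E)); apply/cvgrPdist_le => e e_gt0.
have [|_ [m _ <-] lt_m] := @sup_adherent _ E (e / 2) _ sup_E; first by rewrite divr_gt0.
have e2_gt0 : 0 < e / 2 by rewrite divr_gt0.
near=> n.
have n_gt0 : (0 < n)%N by near: n; exact: nbhs_infty_gt.
have n0 : 0 < n%:R :> R by rewrite ltr0n.
have le_sup : u n / n%:R <= sup E by apply: (sup_upper_bound sup_E); exists n.
rewrite ger0_norm ?subr_ge0 //.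
(* For [m = 0] the ratio is [0] by the convention on the inverse of [0]; then [sup E < e / 2], and
   nonnegative ratios are close enough. *)
have [m0|m_gt0] := posnP m.
  have := divr_ge0 (u0 n) (ltW n0).
  by rewrite m0 invr0 mulr0 in lt_m; lra.
have le_e : u m / n%:R <= e / 2.
  rewrite ler_pdivrMr // mulrC -ler_pdivrMr //; near: n; exact: nbhs_infty_ger.
suff : u m / m%:R - u m / n%:R <= u n / n%:R by lra.
rewrite ler_pdivlMr // mulrBl [_ / n%:R * _]mulfVK ?gt_eqF //.
have le_q : (n %/ m)%:R * u m <= u n.
  apply: le_trans (superadditiveM u0 uD _ _) _; rewrite {2}(divn_eq n m).
  by apply: le_trans (uD _ _); rewrite lerDl.
apply: le_trans le_q; rewrite -[X in _ - X]mul1r mulrAC -mulrA [_ * u m]mulrC.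
rewrite -mulrBr mulrC ler_wpM2r // lerBlDr natr1 ler_pdivrMr ?ltr0n //.
by rewrite -natrM ler_nat ltnW // ltn_ceil.
Unshelve. all: by end_near.
Qed.

Lemma strings_cat m n d (f : strings (m + n) 2 d -> R) :
  \sum_A f A = \sum_(B : strings m 2 d) \sum_(C : strings n 2 d)
    f [ffun i => cat_tuple (B i) (C i)].
Proof.
pose cat_s (BC : strings m 2 d * strings n 2 d) : strings (m + n) 2 d :=
  [ffun i => cat_tuple (BC.1 i) (BC.2 i)].
have take_size (t : (m + n).-tuple letter) : size (take m t) == m.
  by rewrite size_takel // size_tuple leq_addr.
have drop_size (t : (m + n).-tuple letter) : size (drop m t) == n.
  by rewrite size_drop size_tuple addKn.
have bij : bijective cat_s.
  exists (fun A : strings (m + n) 2 d =>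
    ([ffun i => Tuple (take_size (A i))], [ffun i => Tuple (drop_size (A i))])).
    move=> [B C]; congr (_, _); apply/ffunP => i; rewrite !ffunE; apply: val_inj => /=.
      by rewrite take_size_cat ?size_tuple.
    by rewrite drop_size_cat ?size_tuple.
  by move=> A; apply/ffunP => i; rewrite !ffunE; apply: val_inj; rewrite /= cat_take_drop.
by rewrite (reindex cat_s) /=; [rewrite pair_big|exact: onW_bij].
Qed.

Lemma strings_prob_ge0 n d (A : strings n 2 d) : 0 <= strings_prob R A.
Proof. by rewrite strings_probE exprn_ge0 // invr_ge0 exprn_ge0. Qed.

Lemma expectation_lcs_superadditive m n d : (0 < d)%N ->
  expectation_lcs R m 2 d + expectation_lcs R n 2 d <= expectation_lcs R (m + n) 2 d.
Proof.
move=> d_gt0; rewrite [leRHS]/expectation_lcs strings_cat.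
rewrite -[X in X + _]mulr1 -[X in _ + X]mul1r.
rewrite -[X in _ * X + _](strings_prob_sum R n d) -[X in _ + X * _](strings_prob_sum R m d).
rewrite !big_distrlr -big_split /=.
apply: ler_sum => B _; rewrite -big_split /=; apply: ler_sum => C _.
rewrite [X in _ <= X * _](_ : _ = strings_prob R B * strings_prob R C); last first.
  by rewrite !strings_probE exprD invfM exprMn.
rewrite (_ : _ + _ = strings_prob R B * strings_prob R C *
  ((lcs (fun i => B i : seq _))%:R + (lcs (fun i => C i : seq _))%:R)); last by ring.
rewrite ler_wpM2l ?mulr_ge0 ?strings_prob_ge0 // -natrD ler_nat.
have [v /forallP vB <-] := lcs_attained (fun i => B i : seq _).
have [w /forallP wC <-] := lcs_attained (fun i => C i : seq _).
rewrite -size_cat; apply: lcs_max => //; apply/forallP => i; rewrite ffunE /=.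
exact: cat_subseq.
Qed.

Lemma expectation_lcs_bound n d : (0 < d)%N ->
  0 <= expectation_lcs R n 2 d <= n%:R.
Proof.
move=> d_gt0; apply/andP; split.
  by apply: sumr_ge0 => A _; rewrite mulr_ge0 ?strings_prob_ge0.
rewrite -[leRHS]mul1r -[X in _ <= X * _](strings_prob_sum R n d) mulr_suml.
apply: ler_sum => A _.
rewrite ler_wpM2l ?strings_prob_ge0 // ler_nat.
have [w /forallP wA <-] := lcs_attained (fun i => A i : seq _).
by rewrite -(size_tuple (A (Ordinal d_gt0))) size_subseq.
Qed.

Lemma lcs_gamma_cvg d : (0 < d)%N ->
  (expectation_lcs R n 2 d / n%:R @[n --> \oo] --> lcs_gamma R 2 d)%classic.
Proof.
move=> d_gt0; apply: superadditive_is_cvg => [n|m n].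
  exact: expectation_lcs_bound.
exact: expectation_lcs_superadditive.
Qed.

Lemma expectation_lcs1_gt0 : 0 < expectation_lcs R 1 2 2.
Proof.
pose A : strings 1 2 2 := [ffun=> [tuple ord0]].
rewrite /expectation_lcs (bigD1 A) //= ltr_pwDl //; last first.
  by apply: sumr_ge0 => B _; rewrite mulr_ge0 ?strings_prob_ge0.
rewrite mulr_gt0 //; first by rewrite strings_probE exprn_gt0 // invr_gt0 exprn_gt0.
rewrite ltr0n; apply: (@lcs_max _ _ _ [:: ord0]) => //; apply/forallP => i.
by rewrite ffunE.
Qed.

(** A crude linear growth, enough to absorb the constant of [slips_linear] and to make
    [lcs_gamma R 2 2] positive. *)
Lemma expectation_lcs_linear n :
  n%:R * expectation_lcs R 1 2 2 <= expectation_lcs R n 2 2.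
Proof.
have := @superadditiveM (fun n => expectation_lcs R n 2 2) _ _ n 1; rewrite muln1; apply.
  by move=> m; case/andP: (expectation_lcs_bound m (isT : (0 < 2)%N)).
by move=> m l; apply: expectation_lcs_superadditive.
Qed.

Lemma lcs_gamma2_gt0 : 0 < lcs_gamma R 2 2.
Proof.
apply: lt_le_trans expectation_lcs1_gt0 _; apply: limr_ge.
  by apply: cvgP (lcs_gamma_cvg (isT : (0 < 2)%N)).
near=> n; have n_gt0 : (0 < n)%N by near: n; exact: nbhs_infty_gt.
by rewrite ler_pdivlMr ?ltr0n // mulrC expectation_lcs_linear.
Unshelve. all: by end_near.
Qed.

(* Whichever of the two strings has many slips is taken as the centre of the
   star, and then one of its two embeddings is unbalanced. *)
Lemma even_length_gain : exists2 c : R, 0 < c & exists n0 : nat, forall N k,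
  (n0 <= N)%N ->
  (expectation_lcs R N.*2 2 2 / N.*2%:R) ^+ k.+2 +
    c * (expectation_lcs R N.*2 2 2 / N.*2%:R) ^+ k <=
  expectation_lcs R N.*2 2 k.+3 / N.*2%:R.
Proof.
have [c c_gt0 [C slipsP]] := slips_linear R.
pose e1 := expectation_lcs R 1 2 2; have e1_gt0 : 0 < e1 := expectation_lcs1_gt0.
(* Half of the slope [c * e1] is given up to absorb [C], and the other half is shared between the
   two strings. *)
pose delta := c * e1 / 4.
have d_gt0 : 0 < delta by rewrite divr_gt0 ?mulr_gt0.
exists (delta ^+ 2); first by rewrite exprn_gt0.
have [n0 n0P] : exists n0 : nat, C / (2 * delta) <= n0%:R.
  exists (Num.bound `|C / (2 * delta)|); apply: le_trans (ler_norm _) _.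
  by apply/ltW/archi_boundP.
exists n0.+1 => N k le_N; set n := N.*2; set u := expectation_lcs R n 2 2.
have n_gt0 : (0 < n)%N by rewrite double_gt0; apply: leq_trans le_N.
have n0' : 0 < n%:R :> R by rewrite ltr0n.
have C_le : C <= 2 * delta * n%:R.
  rewrite mulrC -ler_pdivrMr ?mulr_gt0 //; apply: le_trans n0P _.
  by rewrite ler_nat /n -addnn; apply: leq_trans (leq_addr _ _); apply: ltnW.
have [wd [wdP wdu wdS]] : exists wd : seq letter -> seq letter -> seq letter,
  [/\ forall A B, subseq (wd A B) A /\ subseq (wd A B) B,
       mean2 n n (fun A B => (size (wd A B))%:R) = u &
       delta * n%:R <= mean2 n n (fun A B => (slips (wd A B) A)%:R)].
  have := slipsP n; set S1 := mean2 n n _; set S2 := mean2 n n _ => le_S.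
  have le_S12 : 2 * (delta * n%:R) <= S1 + S2.
    apply: le_trans le_S; have := ler_wpM2l (ltW c_gt0) (expectation_lcs_linear n).
    rewrite -/e1; move: C_le; rewrite /delta; nra.
  have [S1_ge|S1_lt] := leP (delta * n%:R) S1.
    exists common_word; split=> //; last by rewrite -expectation_lcs2.
    by move=> A B; have [] := common_word_longest A B.
  exists (fun A B => common_word B A); split.
  - by move=> A B; have [] := common_word_longest B A.
  - by rewrite mean2C -expectation_lcs2.
  - by rewrite mean2C -/S2; lra.
pose M b A B := embed b (wd A B) A.
have MP b A B : size A = n -> size B = n ->
    size (M b A B) = n /\ subseq (mask (M b A B) A) B.
  by move=> szA szB; have [wA wB] := wdP A B; rewrite size_embed mask_embed.
have countM b : mean2 n n (fun A B => (count id (M b A B))%:R) = n%:R * (u / n%:R).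
  rewrite mulrC mulfVK ?gt_eqF // -wdu; apply: mean2_ext => A B szA szB.
  have [wA wB] := wdP A B; congr _%:R.
  by rewrite -[wd A B in RHS](mask_embed b wA) size_mask ?size_embed.
pose h b := mean2 n n (fun A B => altsum R false (M b A B)) / n%:R.
have hM b : mean2 n n (fun A B => altsum R false (M b A B)) = n%:R * h b.
  by rewrite mulrC mulfVK ?gt_eqF.
have h_diff : 2 * delta <= h false - h true.
  rewrite -mulrBl ler_pdivlMr // -mulrA.
  rewrite (@mean2_ext _ _ _ (fun A B => altsum R false (M false A B))
    (fun A B => altsum R false (M true A B) + 2 * (slips (wd A B) A)%:R)).
    by rewrite mean2D mean2Z addrAC subrr add0r ler_pM2l.
  by move=> A B _ _; rewrite altsum_embed -mul2n natrM.
suff [b hb] : exists b, delta ^+ 2 <= h b ^+ 2.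
  rewrite ler_pdivlMr // mulrC; apply: le_trans (star_gain k (MP b) (countM b) (hM b)).
  rewrite ler_wpM2l // lerD2l ler_wpM2r // exprn_ge0 // divr_ge0 //.
  by case/andP: (expectation_lcs_bound n (isT : (0 < 2)%N)).
(* Two numbers at distance at least [2 * delta] cannot both lie strictly within [delta] of [0]. *)
have [h0|h0] := leP delta (h false); [exists false|exists true]; nra.
Qed.

(** The constant [c] does not depend on the length, so the gain survives in the limit along even
    lengths, and it is positive because [lcs_gamma R 2 2] is. *)
Lemma lcs_gamma_gt k : lcs_gamma R 2 2 ^+ k.+2 < lcs_gamma R 2 k.+3.
Proof.
have [c c_gt0 [n0 gain]] := even_length_gain.
have even_cvg d : (0 < d)%N ->
    (expectation_lcs R N.*2 2 d / N.*2%:R @[N --> \oo] --> lcs_gamma R 2 d)%classic.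
  move=> d_gt0; apply: cvg_comp (lcs_gamma_cvg d_gt0).
  apply/cvgnyPge => l; near=> N; rewrite -addnn.
  by apply: leq_trans (leq_addr _ _); near: N; exact: nbhs_infty_ge.
have g_gt0 := lcs_gamma2_gt0.
suff : lcs_gamma R 2 2 ^+ k.+2 + c * lcs_gamma R 2 2 ^+ k <= lcs_gamma R 2 k.+3.
  by apply: lt_le_trans; rewrite ltrDl mulr_gt0 ?exprn_gt0.
have poly_cvg : (((expectation_lcs R N.*2 2 2 / N.*2%:R) ^+ k.+2 +
    c * (expectation_lcs R N.*2 2 2 / N.*2%:R) ^+ k) @[N --> \oo] -->
    lcs_gamma R 2 2 ^+ k.+2 + c * lcs_gamma R 2 2 ^+ k)%classic.
  have pow_cvg l : ((expectation_lcs R N.*2 2 2 / N.*2%:R) ^+ l @[N --> \oo] -->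
      lcs_gamma R 2 2 ^+ l)%classic.
    apply: (@continuous_cvg _ _ _ _ _ _ (fun x : R => x ^+ l)); first exact: exprn_continuous.
    exact: even_cvg.
  by apply: cvgD => //; apply: cvgM => //; exact: cvg_cst.
apply: (ler_cvg_to poly_cvg (even_cvg k.+3 isT)).
near=> N; apply: gain; near: N; exact: nbhs_infty_ge.
Unshelve. all: by end_near.
Qed.
End Limit.

Theorem mainTheorem1 (R : realType) :
  (forall d : nat, (3 <= d)%N -> lcs_gamma R 2 d > lcs_gamma R 2 2 ^+ (d - 1)) /\
  lcs_gamma R 2 3 > lcs_gamma R 2 2 ^+ 2 /\
  lcs_gamma R 2 3 <> lcs_gamma R 2 2 ^+ 2.
Proof.
have gamma3 := lcs_gamma_gt R 0; split; last first.
  by split=> // eq3; move: gamma3; rewrite eq3 ltxx.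
case=> [|[|[|k]]] // _; rewrite subn1; exact: lcs_gamma_gt.
Qed.
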